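(* Let $\mathcal A=(Q,\{a,b\},\delta)$ be an automaton in which $b$ acts as a permutation of $Q$ and $a$ is of type $[1,2]\backslash 3$ with $3a=1$, where $1,2,3$ are distinct states of $Q$. Then $\mathcal A$ is $3$-compressible (and proper) if and only if all of the following conditions hold: (1) $\{1,3\}b\ne\{1,3\}$; (2) $b\ne(12)(3)\pi$; (3) if $b=(1)(23)\pi$, or $b=(123)\pi$, or $b=(132)\pi$, then $2a\ne 2$; (4) for every state $4\in Q\setminus\{1,2,3\}$: if $b=(1)(2)(34)\pi$, or $b=(12)(34)\pi$, or $b=(14)(23)\pi$, or $b=(1423)\pi$, or $b=(1324)\pi$, then $4a\ne 2$. Moreover, if $\mathcal A$ is $3$-compressible (and proper), then at least one of the words $a^2ba^2$, $a^2b^2a^2$, $a^2b^3a$, $a^2baba^2$, $ab^3ab^3a$ $3$-compresses $\mathcal A$.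
   Context: A (semi)automaton is $\mathcal A=(Q,\Sigma,\delta)$ with $Q$ a finite set of states, $\Sigma=\{a,b\}$, and $\delta:Q\times\Sigma\to Q$ total. Words act on states from the right, letter by letter from left to right: $qw$ is the state reached from $q$ by reading $w$; for $S\subseteq Q$, $Sw=\{qw:q\in S\}$. A word $w$ $3$-compresses $\mathcal A$ if $|Q|-|Qw|\ge 3$; $\mathcal A$ is $3$-compressible if some word $3$-compresses it. A $3$-compressible automaton is proper if no word of length $3$ $3$-compresses it. The letter $a$ is of type $[1,2]\backslash 3$ if $1a=2a$, no other two distinct states have the same image under $a$, and $Q\setminus Qa=\{3\}$. Permutations are written in disjoint cycle notation, with fixed points sometimes displayed; a cycle $(q_1q_2\ldots q_r)$ means $q_1b=q_2,\ \ldots,\ q_{r-1}b=q_r,\ q_rb=q_1$. For instance $b=(12)(3)\pi$ means $1b=2$, $2b=1$, $3b=3$, and $\pi$ denotes an arbitrary permutation of the states not displayed; ''$b\neq(12)(3)\pi$'' means $b$ is not of this form. States are denoted by numerals and different numerals denote different states; $4$ is a name for an arbitrary state other than $1,2,3$. *)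

(* Defs.v *)
From mathcomp Require Import all_boot.
Set Implicit Arguments.
Unset Strict Implicit.
Unset Printing Implicit Defensive.

Inductive letter := la | lb.

Record semiautomaton := Semiautomaton {
  state :> finType;
  trans : state -> letter -> state
}.

Section Semiautomata.
Variable A : semiautomaton.

Definition act (l : letter) : A -> A := fun q => trans q l.

(* Words act from the right: the leftmost letter is read first. *)
Definition run (q : A) (w : seq letter) : A := foldl (@trans A) q w.

Definition run_set (S : {set A}) (w : seq letter) : {set A} :=
  [set run q w | q in S].

Definition compresses (k : nat) (w : seq letter) : bool :=
  k <= #|A| - #|run_set [set: A] w|.

Definition compressible (k : nat) : Prop := exists w, compresses k w.

Definition proper_3compressible : Prop :=
  compressible 3 /\ forall w, size w = 3 -> ~~ compresses 3 w.

(* The letter l is of type [p,q]\r. *)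
Definition letter_type (l : letter) (p q r : A) : Prop :=
  [/\ p != q, act l p = act l q,
      forall x y, x != y -> act l x = act l y -> [set x; y] = [set p; q]
    & [set: A] :\: run_set [set: A] [:: l] = [set r]].

End Semiautomata.

(* For a permutation f, disjoint_cycles f cs says that the cycles in cs are
   pairwise disjoint cycles of f, i.e. f = (c_1)...(c_k) pi with pi an
   arbitrary permutation of the points not listed; one-point cycles are
   fixed points. *)
Definition disjoint_cycles (T : eqType) (f : T -> T) (cs : seq (seq T)) : bool :=
  uniq (flatten cs) && all (fcycle f) cs.

(* Main.v *)
Require Import Defs.
From mathcomp Require Import all_boot.

(** Write 1, 2, 3 for the states q1, q2, q3, and follow the set M of states
    missing from the image Qw while w is read.  The letter b merely permutes
    M.  The letter a replaces M by Ma and adds the state 3, except that a lone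
    1 or a lone 2 in M leaves no trace, since the other of the two still
    reaches 1a = 2a.  So |M| never decreases; from a set of size 2 it grows
    under a unless M meets {1,2}, and compressing by 3 means leaving the sets
    of size at most 2.

    Reading aa gives M = {1,3}.  Let y be the state other than 1 with ya = 2;
    it is 2 if 2a = 2, and otherwise lies outside {1,2,3}.  A two-element M
    survives aa without growing only if it is stuck, that is, it consists of
    one state of {1,2} and one of {3,y} (a2_gain).

    Necessity.  In each configuration excluded by the conditions there is a
    family of pairs (u,v) with u in {1,2}, containing (1,3), that is closed
    under both letters; M then stays inside such a pair forever (confined).
    The families are {1} x {3}, {1,2} x {3}, the pairs of distinct states in
    {1,2} x {3,2}, and {1,2} x {3,4}, for the four conditions in order.

    Sufficiency.  If none of the short words works, then {1,3}b and {1,3}b^2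
    are stuck, {1,3}b^3 meets {1,2}, and, when {1,3}b contains a state v
    outside {1,2}, the set {3b,vab}, missing after aabab, is stuck too
    (uncompressed).  If y = 2, the first two facts force b to preserve
    {1,2,3}, and the conditions on {1,3}b and on (12)(3) leave only the
    permutations of the third condition (stuck_y2).  Otherwise take 4 = y;
    all these facts together then leave only the permutations listed in the
    fourth condition, which exchange or preserve the blocks {1,2} and {3,4}
    (stuck_y4).

    Properness.  Each a enlarges M by at most one state, and aaa only reaches
    {1,3}. *)

Set Implicit Arguments.
Unset Strict Implicit.
Unset Printing Implicit Defensive.

(** * States missing from the image of a word *)

Section MissingStates.
Variable A : semiautomaton.
Implicit Types (w : seq letter) (l : letter) (p q : A).

Definition missing w : {set A} := ~: run_set [set: A] w.

Lemma compressesE k w : compresses A k w = (k <= #|missing w|).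
Proof. by rewrite /compresses [#|missing w|]cardsCs setCK. Qed.

Lemma missing_nil : missing [::] = set0.
Proof.
by apply/setP=> p; rewrite !inE; apply/negbTE; rewrite negbK; apply/imsetP; exists p.
Qed.

(** A state is missed exactly when all its predecessors were missed; every
    statement about the growth of the missing set is derived from this. *)
Lemma mem_missing_rcons w l p :
  (p \in missing (rcons w l)) = [forall q, (act l q == p) ==> (q \in missing w)].
Proof.
rewrite inE; apply/idP/forallP => [p_out q | all_out].
  apply/implyP=> /eqP lq; rewrite inE; apply: contra p_out => /imsetP[r _ qE].
  by apply/imsetP; exists r; rewrite // /run foldl_rcons -/(run r w) -qE -lq.
apply/imsetP=> -[r _ pE]; have:= all_out (run r w).
rewrite pE /run foldl_rcons eqxx /= inE => /negP[].
by apply/imsetP; exists r.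
Qed.

Lemma compresses_seq w (s : seq A) :
  uniq s -> all [in missing w] s -> compresses A (size s) w.
Proof.
move=> s_uniq /allP s_sub; rewrite compressesE -(card_uniqP s_uniq).
by apply/subset_leq_card/subsetP.
Qed.

Lemma compresses_rcons k w l : compresses A k w -> compresses A k (rcons w l).
Proof.
rewrite /compresses => /leq_trans; apply; apply: leq_sub2l.
have -> : run_set [set: A] (rcons w l) = act l @: run_set [set: A] w.
  by rewrite -imset_comp; apply: eq_imset => q /=; rewrite /run foldl_rcons.
exact: leq_imset_card.
Qed.

(** A newly missing state is either outside the range of the last letter or
    the image of a state that was missing before. *)
Lemma missing_rcons_card w l :
  #|missing (rcons w l)| <= #|~: run_set [set: A] [:: l]| + #|missing w|.
Proof.
set new := ~: _; have sub : missing (rcons w l) \subset new :|: act l @: missing w.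
  apply/subsetP=> p; rewrite mem_missing_rcons => /forallP p_out; rewrite inE orbC.
  case: (boolP (p \in new)) => [|/[!inE]/negPn/imsetP[q _ pE]]; rewrite ?orbT //.
  by rewrite orbF; apply/imsetP; exists q => //; have:= p_out q; rewrite pE eqxx.
apply: leq_trans (subset_leq_card sub) (leq_trans (leq_of_leqif (leq_card_setU _ _)) _).
by rewrite leq_add2l leq_imset_card.
Qed.

End MissingStates.

Arguments missing {A} w.
Arguments missing_rcons_card {A} w l.

(** * How the two letters act on missing states *)

Section Typed.
Variables (A : semiautomaton) (q1 q2 q3 : A).
Notation a := (act (A := A) la).
Notation b := (act (A := A) lb).
Notation missing := (@missing A).
Hypothesis distinct_states : uniq [:: q1; q2; q3].
Hypothesis b_perm : bijective b.
Hypothesis a_type : letter_type la q1 q2 q3.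
Hypothesis a_q3 : a q3 = q1.
Implicit Types (w : seq letter) (u v p q : A).

Lemma q12 : q1 != q2. Proof. by case: a_type. Qed.
Lemma q13 : q1 != q3.
Proof. by move: distinct_states; rewrite /= !inE negb_or -andbA; case/and3P. Qed.
Lemma q23 : q2 != q3.
Proof. by move: distinct_states; rewrite /= !inE negb_or -andbA; case/and4P. Qed.

Lemma a_q1 : a q1 = a q2. Proof. by case: a_type. Qed.

Lemma a_range p : (p \in run_set [set: A] [:: la]) = (p != q3).
Proof.
by case: a_type => _ _ _ /setP/(_ p); rewrite !inE andbT => /(congr1 negb); rewrite negbK.
Qed.

Lemma a_neq3 p : a p != q3.
Proof. by rewrite -a_range; apply/imsetP; exists p. Qed.

Lemma a_fiber p q : p \notin [:: q1; q2] -> a q = a p -> q = p.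
Proof.
move=> p_out aE; case: (eqVneq q p) => // neq; case: a_type => _ _ /(_ _ _ neq aE) E _.
by move: p_out; rewrite !inE -in_set2 -E set22.
Qed.

Lemma q3_out : q3 \notin [:: q1; q2].
Proof. by rewrite !inE !(eq_sym q3) negb_or q13 q23. Qed.

Lemma a_eq1 p : (a p == q1) = (p == q3).
Proof.
by apply/eqP/eqP=> [|->//]; rewrite -a_q3 => /(a_fiber q3_out).
Qed.

Lemma missing_b w p : p \in missing w -> b p \in missing (rcons w lb).
Proof.
move=> p_out; rewrite mem_missing_rcons; apply/forallP=> q; apply/implyP.
by move=> /eqP/(bij_inj b_perm) ->.
Qed.

Lemma missing_a3 w : q3 \in missing (rcons w la).
Proof.
by rewrite mem_missing_rcons; apply/forallP=> q; rewrite (negbTE (a_neq3 q)).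
Qed.

Lemma missing_a w p :
  p \notin [:: q1; q2] -> p \in missing w -> a p \in missing (rcons w la).
Proof.
move=> p12 p_out; rewrite mem_missing_rcons; apply/forallP=> q; apply/implyP.
by move=> /eqP/(a_fiber p12) ->.
Qed.

Lemma missing_a12 w :
  q1 \in missing w -> q2 \in missing w -> a q2 \in missing (rcons w la).
Proof.
move=> out1 out2; rewrite mem_missing_rcons; apply/forallP=> q; apply/implyP.
move=> /eqP aE; case: (boolP (q \in [:: q1; q2])) => [|q_out].
  by rewrite mem_seq2 => /orP[]/eqP->.
by rewrite -(a_fiber q_out (esym aE)).
Qed.

(** Outside {1,2} the letter a is injective on missing states and keeps them
    missing, while 3 is always new. *)
Lemma a_gain w u v : u != v -> u \notin [:: q1; q2] -> v \notin [:: q1; q2] ->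
  u \in missing w -> v \in missing w -> compresses A 3 (rcons w la).
Proof.
move=> neq u12 v12 uw vw.
apply: (@compresses_seq _ _ [:: q3; a u; a v]); last first.
  by rewrite /= missing_a3 !missing_a.
rewrite /= !inE negb_or !(eq_sym q3) !a_neq3 /= andbT.
by apply: contra neq => /eqP/(a_fiber v12) ->.
Qed.

(** The state y is the one through which 2 enters the missing set.  Asking for
    y <> 1 rather than y outside {1,2} lets the cases 2a = 2 (where y = 2) and
    2a <> 2 share the lemmas below. *)
Section Preimage.
Variable y : A.
Hypotheses (a_y : a y = q2) (y_neq1 : y != q1).

Lemma a_in12 p : p != q1 -> a p \in [:: q1; q2] -> p \in [:: q3; y].
Proof.
move=> p1; rewrite !inE a_eq1 -a_y => /orP[->//|/eqP aE].
case: (eqVneq p y) => [->|neq]; first by rewrite orbT.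
case: a_type => _ _ /(_ _ _ neq aE) /setP/(_ q1) E _.
by move: E; rewrite !inE eqxx !(eq_sym q1) (negbTE p1) (negbTE y_neq1).
Qed.

(** These are the two-element missing sets that aa does not enlarge: the first
    a drops the element of {1,2} and turns the pair into {3,va}, where v is
    the other one, and va lies in {1,2} exactly when v is 3 or y (for v <> 1). *)
Definition stuck u v :=
  (u \in [:: q1; q2]) && (v \in [:: q3; y]) ||
  (v \in [:: q1; q2]) && (u \in [:: q3; y]).

Lemma stuckC u v : stuck u v = stuck v u.
Proof. by rewrite /stuck orbC. Qed.

Lemma a2_gain_one w u v : u \in [:: q1; q2] -> v \notin [:: q1; q2] ->
  u \in missing w -> v \in missing w -> ~~ stuck u v ->
  compresses A 3 (rcons (rcons w la) la).
Proof.
rewrite /stuck => u12 v12 uw vw; rewrite u12 (negbTE v12) orbF => v3y.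
have v1 : v != q1 by move: v12; rewrite !inE negb_or => /andP[].
apply: (@a_gain _ q3 (a v)); rewrite ?q3_out ?missing_a3 ?missing_a //.
  by rewrite eq_sym a_neq3.
by apply: contra v3y; apply: a_in12.
Qed.

(** If 1 and 2 are both missing, then so is their common image 2a after a; the
    pair {3,2a} then avoids {1,2}, because 2a = 2 would make y equal to 2. *)
Lemma a2_gain_both w : y != q2 -> q1 \in missing w -> q2 \in missing w ->
  compresses A 3 (rcons (rcons w la) la).
Proof.
move=> y2 w1 w2.
apply: (@a_gain _ q3 (a q2)); rewrite ?q3_out ?missing_a3 ?missing_a12 //.
  by rewrite eq_sym a_neq3.
apply/negP=> /a_in12; rewrite eq_sym q12 !inE (negbTE q23) eq_sym (negbTE y2).
by move/(_ isT).
Qed.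

Lemma a2_gain w u v : u != v -> u \in missing w -> v \in missing w ->
  ~~ stuck u v -> compresses A 3 (rcons (rcons w la) la).
Proof.
move=> neq uw vw ns.
have [u12|u12] := boolP (u \in [:: q1; q2]); have [v12|v12] := boolP (v \in [:: q1; q2]).
(* Two distinct states of {1,2} form a stuck pair when y = 2. *)
- have y2 : y != q2.
    apply: contra ns => /eqP y2; rewrite /stuck y2 u12 v12; move: u12 v12 neq; rewrite !inE.
    by move=> /orP[]/eqP-> /orP[]/eqP->; rewrite ?eqxx ?orbT.
  have [] : q1 \in missing w /\ q2 \in missing w; last exact: a2_gain_both.
  by move: u12 v12 neq uw vw; rewrite !mem_seq2 => /orP[]/eqP-> /orP[]/eqP->; rewrite ?eqxx.
- exact: a2_gain_one ns.
- by rewrite stuckC in ns; apply: a2_gain_one ns.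
- exact/compresses_rcons/(a_gain neq).
Qed.

End Preimage.

(** If u is in {1,2} and u' is the other state of {1,2}, then ua becomes
    missing only when u' is missing too, that is when v = u'; and then
    ua = va.  So the image of u never has to be counted. *)
Lemma a_image_of_pair w u v : u \in [:: q1; q2] ->
  missing w \subset [set u; v] -> missing (rcons w la) \subset [set a v; q3].
Proof.
move=> u12 /subsetP sub; apply/subsetP=> p.
rewrite mem_missing_rcons !inE => /forallP p_out.
have [|p3] := eqVneq p q3; first by rewrite orbT.
move: p3; rewrite orbF -a_range => /imsetP[q _ pE].
have q_in r : a r = p -> (r == u) || (r == v).
  by move=> rp; have:= p_out r; rewrite rp eqxx => /sub; rewrite !inE.
have /orP[/eqP qu|/eqP qv] := q_in q (esym pE); last by rewrite pE -qv.
(* Here p = ua; the other state u' of {1,2} is a predecessor of p too. *)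
pose u' := if u == q1 then q2 else q1.
have aE : a u' = a u.
  by rewrite /u'; move: u12; rewrite !inE; case: eqP => [->|_ /= /eqP->]; rewrite a_q1.
have /orP[] := q_in u' (etrans aE (etrans (congr1 a (esym qu)) (esym pE))).
  rewrite /u' eq_sym; case: (eqVneq u q1) => [->|/negbTE-> //].
  by rewrite (negbTE q12).
by move=> /eqP <-; rewrite aE pE -qu.
Qed.

(** * Necessity: invariant families of pairs *)

(** The invariant is that the missing set lies inside some pair of F.  The
    order of a pair matters for a, which forgets the first element, but not
    for b, which may therefore exchange the two. *)
Lemma confined (F : rel A) :
    F q1 q3 ->
    (forall u v, F u v -> u \in [:: q1; q2]) ->
    (forall u v, F u v -> F (a v) q3) ->
    (forall u v, F u v -> F (b u) (b v) || F (b v) (b u)) ->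
  ~ compressible A 3.
Proof.
move=> F13 F12 Fa Fb [w].
have [u [v [_ sub]]] : exists u v, F u v /\ missing w \subset [set u; v].
  elim/last_ind: w => [|w l [u [v [Fuv sub]]]].
    by exists q1, q3; rewrite missing_nil sub0set.
  case: l.
    exists (a v), q3; split; first exact: Fa Fuv.
    exact: a_image_of_pair (F12 _ _ Fuv) sub.
  have sub' : missing (rcons w lb) \subset [set b u; b v].
    apply/subsetP=> p; rewrite mem_missing_rcons => /forallP p_out.
    have [g _ gK] := b_perm; have:= p_out (g p); rewrite [act _ _]gK eqxx.
    by move/(subsetP sub); rewrite !inE => /orP[]/eqP<-; rewrite gK eqxx ?orbT.
  have /orP[Fb'|Fb'] := Fb _ _ Fuv; first by exists (b u), (b v).
  by exists (b v), (b u); rewrite setUC.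
rewrite compressesE; apply/negP; rewrite -ltnNge ltnS.
by apply: leq_trans (subset_leq_card sub) _; rewrite cards2; case: (_ != _).
Qed.

(** * Properness *)

Lemma missing_card_count w :
  #|missing w| <= count (fun l => if l is la then true else false) w.
Proof.
elim/last_ind: w => [|w l IH]; first by rewrite missing_nil cards0.
apply: leq_trans (missing_rcons_card w l) _.
rewrite -cats1 count_cat addnC leq_add //=; case: l.
  by case: a_type => _ _ _; rewrite setTD => ->; rewrite cards1.
rewrite leqn0 cards_eq0; apply/eqP/setP=> p; rewrite !inE; apply/negbTE.
by rewrite negbK; have [g _ gK] := b_perm; apply/imsetP; exists (g p); rewrite // [RHS]gK.
Qed.

(** By the letter count only aaa could qualify, but its first two letters
    already reach the pair {1,3}, which a maps to itself. *)
Lemma not_compresses_length3 w : size w = 3 -> ~~ compresses A 3 w.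
Proof.
rewrite compressesE -ltnNge ltnS.
have a_step w' : missing w' \subset [set q1; q3] -> missing (rcons w' la) \subset [set q1; q3].
  by move=> sub; rewrite -{1}a_q3; apply: a_image_of_pair sub; rewrite inE eqxx.
have aaa_sub : missing [:: la; la; la] \subset [set q1; q3].
  by apply: (a_step [:: la; la]); apply: (a_step [:: la]); apply: (a_step [::]);
    rewrite missing_nil sub0set.
case: w => [|[] [|[] [|[] [|//]]]] // _; try exact: leq_trans (missing_card_count _) _.
by apply: leq_trans (subset_leq_card aaa_sub) _; rewrite cards2; case: (_ != _).
Qed.

(** * The permutations excluded by the conditions *)

Lemma b_neq u v : u != v -> b u != b v.
Proof. by apply: contra => /eqP/(bij_inj b_perm)->. Qed.

Ltac split_hyps :=
  repeat match goal with
  | H : is_true (_ && _) |- _ => case/andP: H => ? ?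
  | H : is_true (_ || _) |- _ => case/orP: H => ?
  | H : is_true (_ == _) |- _ => move/eqP: H => H
  end.

Definition conditions :=
    [/\ run_set [set q1; q3] [:: lb] != [set q1; q3],
        ~~ disjoint_cycles b [:: [:: q1; q2]; [:: q3]],
        [\/ disjoint_cycles b [:: [:: q1]; [:: q2; q3]],
            disjoint_cycles b [:: [:: q1; q2; q3]]
          | disjoint_cycles b [:: [:: q1; q3; q2]]] ->
        a q2 <> q2
      & forall q4 : A, q4 \notin [:: q1; q2; q3] ->
        disjoint_cycles b [:: [:: q1]; [:: q2]; [:: q3; q4]] \/
        disjoint_cycles b [:: [:: q1; q2]; [:: q3; q4]] \/
        disjoint_cycles b [:: [:: q1; q4]; [:: q2; q3]] \/
        disjoint_cycles b [:: [:: q1; q4; q2; q3]] \/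
        disjoint_cycles b [:: [:: q1; q3; q2; q4]] ->
        a q4 <> q2].

(** Checks closure under b of a family given by membership in explicit lists,
    when the images of the listed states are known. *)
Ltac chase_b :=
  move=> u v; rewrite !inE;
  repeat match goal with
  | |- is_true (_ && _) -> _ => case/andP
  | |- is_true (_ || _) -> _ => case/orP
  | |- is_true (_ == _) -> _ => move/eqP->
  | |- is_true (_ != _) -> _ => 
      let N := fresh "neq" in rewrite ?eqxx; move=> N; try by case/negP: N
  | H : act lb ?x = _ |- context [act lb ?x] => rewrite H
  end; rewrite ?eqxx ?orbT //.

Lemma compressible_conditions : compressible A 3 -> conditions.
Proof.
move=> comp; rewrite /conditions; split.
- apply/negP=> /eqP; rewrite /run_set imsetU1 imset_set1 => /setP E.
  have neq := b_neq q13.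
  have := E (b q1); have := E (b q3); rewrite !inE !eqxx orbT /= => /esym/orP b3 /esym/orP b1.
  apply: (@confined (fun u v => (u == q1) && (v == q3))) comp.
  + by rewrite !eqxx.
  + by move=> u v /andP[/eqP-> _]; rewrite inE eqxx.
  + by move=> u v /andP[_ /eqP->]; rewrite a_q3 !eqxx.
  + move=> u v /andP[/eqP-> /eqP->].
    by move: neq; case: b3 => /eqP->; case: b1 => /eqP->; rewrite !eqxx ?orbT.
- apply/negP; rewrite /disjoint_cycles /= => ?; split_hyps.
  apply: (@confined (fun u v => (u \in [:: q1; q2]) && (v \in [:: q3]))) comp.
  + by rewrite !inE !eqxx.
  + by move=> u v /andP[].
  + by move=> u v /andP[_ /[!inE]/eqP->]; rewrite a_q3 !eqxx.
  + by chase_b.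
- move=> cyc a2; have neqs := (q12, q13, q23, eq_sym q2 q1, eq_sym q3 q1, eq_sym q3 q2).
  apply: (@confined (fun u v => [&& u \in [:: q1; q2], v \in [:: q3; q2] & u != v])) comp.
  + by rewrite !inE !eqxx !neqs.
  + by move=> u v /and3P[].
  + move=> u v /and3P[_ /[!inE]/orP[]/eqP-> _];
      by rewrite ?a_q3 ?a2 !eqxx ?neqs ?orbT ?neqs.
  + by case: cyc; rewrite /disjoint_cycles /= => ?; split_hyps; chase_b;
      rewrite ?neqs ?orbT.
- move=> q4 _ cyc a4.
  apply: (@confined (fun u v => (u \in [:: q1; q2]) && (v \in [:: q3; q4]))) comp.
  + by rewrite !inE !eqxx.
  + by move=> u v /andP[].
  + by move=> u v /andP[_ /[!inE]/orP[]/eqP->]; rewrite ?a_q3 ?a4 !eqxx ?orbT.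
  + by move: cyc; rewrite /disjoint_cycles /= => -[|[|[|[|]]]] ?; split_hyps; chase_b.
Qed.

(** * Sufficiency: the short words *)

Definition short_words := [:: [:: la; la; lb; la; la];
            [:: la; la; lb; lb; la; la];
            [:: la; la; lb; lb; lb; la];
            [:: la; la; lb; la; lb; la; la];
            [:: la; lb; lb; lb; la; lb; lb; lb; la]].

Lemma q2_preimage : exists2 y, a y = q2 & y != q1.
Proof.
have /imsetP[y _ yE] : q2 \in run_set [set: A] [:: la] by rewrite a_range q23.
have [y1|] := eqVneq y q1; last by exists y.
(* If 1 is a preimage of 2, then so is 2, as 1a = 2a. *)
by exists q2; rewrite ?(eq_sym q2) ?q12 // [RHS]yE /run /= -/(act la y) y1 a_q1.
Qed.

Lemma missing_aa : (q1 \in missing [:: la; la]) * (q3 \in missing [:: la; la]).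
Proof.
split; last exact: (missing_a3 [:: la]).
by have:= missing_a q3_out (missing_a3 [::]); rewrite a_q3.
Qed.

(** Reading aa makes 1 and 3 missing.  The first three conclusions come from
    pushing this pair along powers of b; the last one comes from aabab, whose
    third a contributes the missing state 3 next to va. *)
Lemma uncompressed y : a y = q2 -> y != q1 -> ~~ has (compresses A 3) short_words ->
  [/\ stuck y (b q1) (b q3), stuck y (b (b q1)) (b (b q3)),
      (b (b (b q1)) \in [:: q1; q2]) || (b (b (b q3)) \in [:: q1; q2])
    & forall v, v \in [:: b q1; b q3] -> v \notin [:: q1; q2] ->
        stuck y (b q3) (b (a v))].
Proof.
move=> ay y1; rewrite /short_words /= !negb_or => /and5P[nc1 nc2 nc3 nc4 _].
have [m1 m3] := missing_aa.
have m1b : b q1 \in missing [:: la; la; lb] := missing_b m1.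
have m3b : b q3 \in missing [:: la; la; lb] := missing_b m3.
have m1bb : b (b q1) \in missing [:: la; la; lb; lb] := missing_b m1b.
have m3bb : b (b q3) \in missing [:: la; la; lb; lb] := missing_b m3b.
have n13 := b_neq q13; have nn13 := b_neq n13.
split.
- by apply: contraR nc1; apply: (a2_gain ay y1 (w := [:: la; la; lb])).
- by apply: contraR nc2; apply: (a2_gain ay y1 (w := [:: la; la; lb; lb])).
- apply: contraR nc3; rewrite negb_or => /andP[n1 n3].
  by apply: (a_gain (b_neq nn13) n1 n3 (w := [:: la; la; lb; lb; lb]));
    apply: (missing_b (w := [:: la; la; lb; lb])).
- move=> v v_in v12; apply: contraR nc4.
  apply: (a2_gain ay y1 (w := [:: la; la; lb; la; lb])).
  + by apply: b_neq; rewrite eq_sym a_neq3.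
  + exact: missing_b (missing_a3 [:: la; la; lb]).
  + apply: (missing_b (w := [:: la; la; lb; la])).
    apply: (missing_a (w := [:: la; la; lb])) => //.
    by move: v_in; rewrite mem_seq2 => /orP[]/eqP->.
Qed.

(** Refutes a partial table of values of b that contradicts functionality or
    injectivity, given the inequalities between the named states. *)
Ltac b_contra :=
  match goal with
  | E : ?x = ?y, N : is_true (?x != ?y) |- _ => by rewrite E eqxx in N
  | E : ?x = ?y, E' : ?x = ?z, N : is_true (?y != ?z) |- _ => by rewrite -E -E' eqxx in N
  | E : act lb ?x = ?z, E' : act lb ?y = ?z, N : is_true (?x != ?y) |- _ =>
      by have := b_neq N; rewrite E E' eqxx
  end.

Ltac rewrite_b_in H :=
  repeat match goal with E : act lb ?x = _ |- _ =>
    match type of H with context [act lb x] => rewrite E in H end end.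

Ltac check_cycles :=
  rewrite /disjoint_cycles /= !inE;
  repeat match goal with
  | E : act lb ?x = _ |- context [act lb ?x] => rewrite E
  | N : is_true (?x != ?y) |- context [?x == ?y] => rewrite (negbTE N)
  end; rewrite ?eqxx.

Lemma pair13_fixed : run_set [set q1; q3] [:: lb] != [set q1; q3] ->
  (b q1 = q1 -> b q3 = q3 -> False) /\ (b q1 = q3 -> b q3 = q1 -> False).
Proof.
rewrite /run_set imsetU1 imset_set1 /run /= -!/(act lb _) => neq.
split=> E1 E3; case/negP: neq; rewrite E1 E3 //.
by rewrite setUC.
Qed.

(** The four states 1b, 3b, 1bb, 3bb lie in {1,2,3}.  As {1,3}b is not {1,3},
    it contains 2, so 2b is in {1,2,3} as well and b permutes {1,2,3}. *)
Lemma stuck_y2 : run_set [set q1; q3] [:: lb] != [set q1; q3] ->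
    ~~ disjoint_cycles b [:: [:: q1; q2]; [:: q3]] ->
    stuck q2 (b q1) (b q3) -> stuck q2 (b (b q1)) (b (b q3)) ->
  [\/ disjoint_cycles b [:: [:: q1]; [:: q2; q3]],
      disjoint_cycles b [:: [:: q1; q2; q3]]
    | disjoint_cycles b [:: [:: q1; q3; q2]]].
Proof.
move=> /pair13_fixed[c1 c1'] /negP c2; rewrite /stuck !mem_seq2 => s1.
have n12 := q12; have n13 := q13; have n23 := q23; have n31 := q13; have n32 := q23.
have n21 := q12; rewrite eq_sym in n21; rewrite eq_sym in n31; rewrite eq_sym in n32.
split_hyps; try b_contra; try by [exfalso; exact: c1 | exfalso; exact: c1'];
move=> s2; rewrite_b_in s2; split_hyps; try b_contra.
all: try by [exfalso; apply: c2; check_cycles | constructor 1; check_cycles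
  | constructor 2; check_cycles | constructor 3; check_cycles].
Qed.

(** The first two stuck pairs determine b on 1, 3 and on one or two further
    states of {2,4}.  The last two hypotheses then exclude the cyclic orders
    that mix the blocks {1,2} and {3,4}, and any 2b or 4b outside
    {1,2,3,4}. *)
Lemma stuck_y4 q4 : run_set [set q1; q3] [:: lb] != [set q1; q3] ->
    ~~ disjoint_cycles b [:: [:: q1; q2]; [:: q3]] ->
    q4 \notin [:: q1; q2; q3] ->
    stuck q4 (b q1) (b q3) -> stuck q4 (b (b q1)) (b (b q3)) ->
    (b (b (b q1)) \in [:: q1; q2]) || (b (b (b q3)) \in [:: q1; q2]) ->
    (q4 \in [:: b q1; b q3] -> stuck q4 (b q3) (b q2)) ->
  disjoint_cycles b [:: [:: q1]; [:: q2]; [:: q3; q4]] \/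
  disjoint_cycles b [:: [:: q1; q2]; [:: q3; q4]] \/
  disjoint_cycles b [:: [:: q1; q4]; [:: q2; q3]] \/
  disjoint_cycles b [:: [:: q1; q4; q2; q3]] \/
  disjoint_cycles b [:: [:: q1; q3; q2; q4]].
Proof.
move=> /pair13_fixed[c1 c1'] /negP c2; rewrite !inE !negb_or => /and3P[n41 n42 n43].
rewrite /stuck !mem_seq2 => s1.
have n12 := q12; have n13 := q13; have n23 := q23; have n31 := q13; have n32 := q23.
have n21 := q12; rewrite eq_sym in n21; rewrite eq_sym in n31; rewrite eq_sym in n32.
have n14 := n41; have n24 := n42; have n34 := n43.
rewrite eq_sym in n14; rewrite eq_sym in n24; rewrite eq_sym in n34.
split_hyps; try b_contra; try by [exfalso; exact: c1 | exfalso; exact: c1'];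
move=> s2; rewrite_b_in s2; split_hyps; try b_contra;
try by [exfalso; apply: c2; check_cycles];
move=> s3; rewrite_b_in s3; split_hyps; try b_contra;
move=> s4; rewrite_b_in s4; try (move: s4; rewrite eqxx ?orbT => /(_ isT) s4);
split_hyps; try b_contra.
all: try by [constructor 1; check_cycles
  | constructor 2; constructor 1; check_cycles
  | do 2 constructor 2; constructor 1; check_cycles
  | do 3 constructor 2; constructor 1; check_cycles
  | do 4 constructor 2; check_cycles].
Qed.

Lemma conditions_compress : conditions -> has (compresses A 3) short_words.
Proof.
case=> c1 c2 c3 c4; apply/negPn/negP=> nc.
have [y ay y1] := q2_preimage.
have [s1 s2 s3 s4] := uncompressed ay y1 nc.
have [y2|y2] := eqVneq y q2.
  by move: ay s1 s2; rewrite y2 => a2 s1 s2; apply: (c3 _ a2); apply: stuck_y2.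
have y3 : y != q3.
  by apply/eqP=> y3; have:= q12; rewrite -ay y3 a_q3 eqxx.
have y_out : y \notin [:: q1; q2; q3] by rewrite !inE !negb_or y1 y2.
apply: (c4 y y_out _ ay); apply: stuck_y4 => // y_in.
have := s4 y y_in; rewrite ay; by apply; rewrite mem_seq2 negb_or y1.
Qed.

Lemma compressible_short_words : has (compresses A 3) short_words -> compressible A 3.
Proof. by case/(has_nthP [::])=> i _ cw; exists (nth [::] short_words i). Qed.

End Typed.

Theorem proposition11 (A : semiautomaton) (q1 q2 q3 : A)
    (distinct_states : uniq [:: q1; q2; q3])
    (b_perm : bijective (act (A := A) lb))
    (a_type : letter_type la q1 q2 q3)
    (a_q3 : act la q3 = q1) :
  let a := act (A := A) la in
  let b := act (A := A) lb in
  let conditions :=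
    [/\ run_set [set q1; q3] [:: lb] != [set q1; q3],
        ~~ disjoint_cycles b [:: [:: q1; q2]; [:: q3]],
        [\/ disjoint_cycles b [:: [:: q1]; [:: q2; q3]],
            disjoint_cycles b [:: [:: q1; q2; q3]]
          | disjoint_cycles b [:: [:: q1; q3; q2]]] ->
        a q2 <> q2
      & forall q4 : A, q4 \notin [:: q1; q2; q3] ->
        disjoint_cycles b [:: [:: q1]; [:: q2]; [:: q3; q4]] \/
        disjoint_cycles b [:: [:: q1; q2]; [:: q3; q4]] \/
        disjoint_cycles b [:: [:: q1; q4]; [:: q2; q3]] \/
        disjoint_cycles b [:: [:: q1; q4; q2; q3]] \/
        disjoint_cycles b [:: [:: q1; q3; q2; q4]] ->
        a q4 <> q2]
  in
  [/\ compressible A 3 <-> conditions,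
      proper_3compressible A <-> conditions
    & compressible A 3 ->
      has (compresses A 3)
        [:: [:: la; la; lb; la; la];
            [:: la; la; lb; lb; la; la];
            [:: la; la; lb; lb; lb; la];
            [:: la; la; lb; la; lb; la; la];
            [:: la; lb; lb; lb; la; lb; lb; lb; la]]].
Proof.
have nec := compressible_conditions distinct_states b_perm a_type a_q3.
have suf := conditions_compress distinct_states b_perm a_type a_q3.
move=> a b conds; split; last by move=> /nec /suf.
  by split=> [/nec|/suf/compressible_short_words].
split=> [[/nec]//|/suf/compressible_short_words comp]; split=> // w.
exact: (not_compresses_length3 b_perm a_type a_q3).
Qed.
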